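(* Let $p \in \mathbb{C}$. Then for Lebesgue almost every $\alpha \in \mathbb{R}$, $$\overline{\exp \circ \exp (L_\alpha(p))} = \mathbb{C},$$ i.e. the image of the line $L_\alpha(p)$ under $\exp\circ\exp$ is dense in $\mathbb{C}$.
   Context: Here $\exp : \mathbb{C} \to \mathbb{C}$, $z \mapsto e^z$, is the complex exponential. For $p \in \mathbb{C}$ and $\alpha \in \mathbb{R}$, $L_\alpha(p) := \{p + t(i+\alpha) : t \in \mathbb{R}\}$ is a (non-horizontal) line through $p$. The overline denotes closure in $\mathbb{C}$. *)

(* Defs.v *)
From mathcomp Require Import all_boot all_order all_algebra.
From mathcomp Require Import all_classical all_reals all_analysis.
From mathcomp Require Export complex.

Set Implicit Arguments.
Unset Strict Implicit.
Unset Printing Implicit Defensive.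

Import Order.TTheory GRing.Theory Num.Theory.
Import numFieldNormedType.Exports.

Local Open Scope classical_set_scope.
Local Open Scope ring_scope.
Local Open Scope complex_scope.

(* e^(x + iy) = e^x (cos y + i sin y) *)
Definition expC (R : realType) (z : R[i]) : R[i] :=
  (expR (complex.Re z))%:C * (cos (complex.Im z) +i* sin (complex.Im z)).

Lemma expC_real (R : realType) (x : R) : expC x%:C = (expR x)%:C.
Proof. by rewrite /expC /= cos0 sin0 mulr1. Qed.

Lemma expCD (R : realType) (z w : R[i]) : expC (z + w) = expC z * expC w.
Proof.
case: z w => [a b] [c d]; rewrite /expC /= expRD cosD sinD mulrACA -rmorphM.
by congr (_ * _); simpc; rewrite [X in _ +i* X]addrC.
Qed.

Definition lineC (R : realType) (alpha : R) (p : R[i]) : set R[i] :=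
  [set p + t%:C * ('i%C + alpha%:C) | t in [set: R]].

(* Main.v *)
Require Import Defs.
From mathcomp Require Import all_boot all_order all_algebra.
From mathcomp Require Import all_classical all_reals all_analysis.
From mathcomp Require Import ring lra.

(** Write [p = a + i b]. The exponential maps the line through [p] to the
    logarithmic spiral whose point of parameter [t] has modulus
    [X = exp (a + t alpha)] and argument [b + t]. The second exponential of a
    point [x + i y] depends only on [x] and on [y] modulo [2 pi], so the spiral
    has to be dense in the cylinder obtained by taking [y] modulo [2 pi].
    Far out, the spiral meets a fixed vertical strip only close to the imaginary
    axis, where its branches are nearly vertical translations of each other:
    the branch crossing the positive imaginary axis at height [X] passes, up to
    a vanishing error, through [u + i (X - alpha u)] for every real [u]
    ([expC_near_crossing], [closure_expC_expC]). Density thus follows once the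
    heights [X = exp (a + s alpha)], with [s] running over the arithmetic
    progression [pi / 2 - b + 2 pi k], come arbitrarily far up arbitrarily close
    to every class modulo [2 pi].

    For almost every [alpha] they do ([ae_exp_dense]). As a function of [alpha],
    the height [exp (a + s alpha)] oscillates modulo [2 pi] very fast when
    [s alpha] is large, and with bounded distortion on each period: every small
    interval of length one period contains a fixed proportion of parameters for
    which the height is close to the prescribed class ([exp_wave_hole]). The set
    of parameters [alpha] that miss this class for all large heights is thus
    porous, and porous sets are null by the Lebesgue density theorem
    ([porous_null]). Since [alpha] may have either sign, [s] is taken from both
    ends of the progression ([crossings_unbounded]). *)

Set Implicit Arguments.
Unset Strict Implicit.
Unset Printing Implicit Defensive.

Import Order.TTheory GRing.Theory Num.Theory.
Import numFieldNormedType.Exports.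

Local Open Scope classical_set_scope.
Local Open Scope ring_scope.

(** * Porous sets are null *)

Lemma ball_subset_dist (R : realType) (x y r d : R) :
  `|x - y| + d <= r -> ball y d `<=` ball x r.
Proof.
move=> h z; rewrite -!ball_normE /= => hz.
rewrite (le_lt_trans (ler_distD y _ _))//.
by rewrite (lt_le_trans _ h)// ltrD2l.
Qed.

(** A porous set has, at each of its points, density at most [1 - kappa] along
    a sequence of shrinking balls, whereas by the Lebesgue density theorem
    almost every point of a measurable set is a point of density 1. *)
Lemma porous_null (R : realType) (E : set R) (kappa : R) :
  measurable E -> 0 < kappa ->
  (forall x, E x -> forall eps, 0 < eps -> exists rho y,
    [/\ 0 < rho < eps, ball y (kappa * rho) `<=` ball x rho &
        ball y (kappa * rho) `&` E = set0]) ->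
  lebesgue_measure E = 0%E.
Proof.
move=> mE k0 porE; apply/negligibleP => //.
have := lebesgue_density mE.
apply: (@negligibleS) => x Ex /= dens; have := dens.
rewrite indicE mem_set// => /fine_cvgP[_] /cvgrPdist_lt /(_ _ k0).
move=> [e /= e0 he].
have [rho [y [/andP[r0 re] sub dis]]] := porE x Ex e e0.
have := he rho; rewrite /ball_/= sub0r normrN gtr0_norm// => /(_ re r0).
set q := fine _; move=> hq.
have krho0 : 0 < kappa * rho by rewrite mulr_gt0.
have hm : (lebesgue_measure (E `&` ball x rho) <=
    ((rho - kappa * rho) *+ 2)%:E)%E.
  apply: (@le_trans _ _
    (lebesgue_measure (ball x rho `\` ball y (kappa * rho)))).
    apply: le_measure; rewrite ?inE.
    - by apply: measurableI => //; exact: measurable_realfun.measurable_ball.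
    - by apply: measurableD; exact: measurable_realfun.measurable_ball.
    - move=> z [Ez xz]; split=> // yz.
      by have : set0 z by rewrite -dis.
  rewrite measureD; [|exact: measurable_realfun.measurable_ball|
                      exact: measurable_realfun.measurable_ball|]; last first.
    by rewrite [ltLHS](lebesgue_measure_ball x (ltW r0)) ltry.
  rewrite (_ : _ `&` _ = ball y (kappa * rho)); last first.
    by apply/seteqP; split => z; [case|split=> //; exact: sub].
  rewrite [X in (X - _)%E](lebesgue_measure_ball x (ltW r0)).
  rewrite [X in (_ - X)%E](lebesgue_measure_ball y (ltW krho0)).
  by rewrite -EFinB lee_fin mulrnBl.
move: hq; rewrite ltNge => /negP; apply.
have hr2 : rho *+ 2 > 0 by rewrite pmulrn_lgt0.
have -> : q = fine (lebesgue_measure (E `&` ball x rho)) / (rho *+ 2).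
  rewrite /q lebesgue_measure_ball ?ltW// inver gt_eqF// fineM//.
  rewrite ge0_fin_numE//; apply: le_lt_trans hm _; exact: ltry.
have hf : fine (lebesgue_measure (E `&` ball x rho)) <=
    (rho - kappa * rho) *+ 2.
  rewrite -[leRHS]/(fine (((rho - kappa * rho) *+ 2)%:E)) fine_le//.
  rewrite ge0_fin_numE//; apply: le_lt_trans hm _; exact: ltry.
apply: le_trans (ler_norm _); rewrite lerBrDl -lerBrDr ler_pdivrMr//.
apply: le_trans hf _; rewrite le_eqVlt; apply/orP; left; apply/eqP; ring.
Qed.

(** * Exponential waves modulo a period *)

Lemma expR_dist1 (R : realType) (h : R) :
  `|h| <= 2^-1 -> `|expR h - 1| <= 2 * `|h|.
Proof.
move=> hh; have := expR_ge1Dx h; have h2 := expR_ge1Dx (- h).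
have e0 := expR_gt0 h; have : expR h * expR (- h) = 1.
  by rewrite -expRD subrr expR0.
move=> h3.
have [h0|h0] := leP 0 h; [rewrite (ger0_norm h0)|rewrite (ltr0_norm h0)] => h4.
  have hh' : h <= 2^-1 by rewrite -(ger0_norm h0).
  rewrite ger0_norm; last lra.
  nra.
have h5 : expR h <= 1 by rewrite -expR0 ler_expR ltW.
rewrite ler0_norm; lra.
Qed.

(** Near [x] the wave [z |-> expR (a + s * z)] is almost affine with the huge
    slope [Y * s], where [Y] is its value at [x]. On a ball of radius about
    [T / (Y * |s|)] it therefore runs through a full period [T], and it stays
    within [r] of the class of [c] modulo [T] on a definite proportion
    [r / (4 * (T + r))] of that ball, independent of [s] and [x]. *)
Lemma exp_wave_hole (R : realType) (T a c r s x : R) :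
  s != 0 -> 0 < T -> 0 < r <= 1 -> T + 1 <= expR (a + s * x) ->
  let rho := (T + r) / (expR (a + s * x) * `|s|) in
  exists y (k : int),
    ball y (r / (4 * (T + r)) * rho) `<=` ball x rho /\
    forall z, ball y (r / (4 * (T + r)) * rho) z ->
      expR (a + s * x) - 1 < expR (a + s * z) /\
      `|expR (a + s * z) - (c + k%:~R * T)| < r.
Proof.
move=> s0 T0 /andP[r0 r1]; set Y := expR _ => hY rho.
have Y0 : 0 < Y by exact: expR_gt0.
have s0' : 0 < `|s| by rewrite normr_gt0.
have -> : r / (4 * (T + r)) * rho = r / (4 * Y) / `|s|.
  by rewrite /rho; field; rewrite ?gt_eqF//; lra.
(* [C] is the first representative of the class of [c] at or above [Y], and
   [y] is the point where the wave takes the value [C]. *)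
pose k : int := Num.ceil ((Y - c) / T).
pose C := c + k%:~R * T.
have hC : Y <= C <= Y + T.
  have : k%:~R - 1 < (Y - c) / T <= k%:~R.
    by have := ceil_itv ((Y - c) / T); rewrite intrB.
  rewrite ltr_pdivlMr// ler_pdivrMr// /C; set K := k%:~R; lra.
have C0 : 0 < C by lra.
pose y := (ln C - a) / s.
have hy : a + s * y = ln C by rewrite /y; field.
exists y, k; split.
  apply: ball_subset_dist.
  have : `|x - y| * `|s| <= T / Y.
    rewrite -normrM (_ : _ * s = ln Y - ln C); last first.
      by rewrite -hy /Y expRK; ring.
    rewrite distrC ger0_norm; last by rewrite subr_ge0 ler_ln ?posrE//; lra.
    rewrite -ln_div ?posrE// -ler_expR lnK ?posrE ?divr_gt0//.
    apply: le_trans (expR_ge1Dx _).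
    rewrite ler_pdivrMr// mulrDl mulfVK ?gt_eqF//; lra.
  rewrite -ler_pdivlMr// => h; apply: (le_trans (lerD h (lexx _))).
  rewrite -mulrDl /rho [(Y * _)^-1]invfM mulrA ler_pM2r ?invr_gt0//.
  rewrite invfM mulrA -mulrDl ler_pM2r ?invr_gt0//. lra.
move=> z; rewrite -ball_normE /= -(ltr_pM2r s0') mulfVK ?gt_eqF//.
rewrite distrC -normrM mulrC => hz.
have hrY : r / (4 * Y) <= 2^-1 by rewrite ler_pdivrMr; lra.
have := expR_dist1 (ltW (lt_le_trans hz hrY)).
set h := s * (z - y) in hz * => hh.
have -> : expR (a + s * z) = C * expR h.
  by rewrite -{1}(lnK C0) -hy -expRD; congr expR; rewrite /h; ring.
have {}hh : `|C * expR h - C| < r.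
  rewrite -{2}[C]mulr1 -mulrBr normrM gtr0_norm//.
  apply: (@le_lt_trans _ _ (C * (2 * `|h|))); first by rewrite ler_pM2l.
  apply: (@le_lt_trans _ _ (2 * Y * (2 * `|h|))).
    by apply: ler_wpM2r; [rewrite mulr_ge0|lra].
  move: hz; rewrite ltr_pdivlMr; lra.
by split=> //; move: hh; rewrite ltr_norml => /andP[]; lra.
Qed.

(** The exceptional set is porous: if no frequency [s] of [S] works at [x <> 0],
    then taking [s * x] large makes both the wave large and [|s|] large, so
    [exp_wave_hole] produces holes of a fixed proportion in arbitrarily small
    balls around [x]. *)
Lemma ae_exp_hits (R : realType) (T a : R) (S : set R) (N c r : R) :
  0 < T -> 0 < r <= 1 ->
  (forall x : R, x != 0 -> forall M, exists2 s, S s & M <= s * x) ->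
  {ae lebesgue_measure, forall x, exists s (k : int),
    [/\ S s, N < expR (a + s * x) &
        `|expR (a + s * x) - (c + k%:~R * T)| < r]}.
Proof.
move=> T0 r01 hS; have /andP[r0 r1] := r01.
pose U : set R := [set y | N < y] `&` \bigcup_(k : int) ball (c + k%:~R * T) r.
pose E := \bigcap_(s in S) ((fun x => expR (a + s * x)) @^-1` ~` U) `\` [set 0].
have oU : open U.
  apply: openI; first exact: open_gt.
  by apply: bigcup_open => k _; exact: ball_open.
have cX (s : R) : continuous (fun x : R => expR (a + s * x)).
  move=> x; apply: (@continuous_comp _ _ _ (fun x : R => a + s * x) expR).
    apply: cvgD; first exact: cvg_cst.
    by apply: cvgM; [exact: cvg_cst|exact: cvg_id].
  exact: continuous_expR.
have mE : measurable E.
  apply: measurableD; last exact: measurable_set1.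
  apply: measurable_realfun.closed_measurable; apply: closed_bigI => s _.
  by apply: preimage_closed => //; exact: open_closedC.
have E0 : lebesgue_measure E = 0%E.
  apply: (@porous_null _ _ (r / (4 * (T + r)))) => //.
    by rewrite divr_gt0//; lra.
  move=> x [Ex /eqP x0] eps eps0.
  (* The summands of this bound absorb [a], bring the wave above [T + 1] and
     [N + 1], and make the radius of [exp_wave_hole] smaller than [eps]. *)
  have [s Ss] := hS x x0 (`|a| + T + `|N| + 2 + `|x| * ((T + 1) / eps)).
  have x0' : 0 < `|x| by rewrite normr_gt0.
  have q0 : 0 < (T + 1) / eps by rewrite divr_gt0//; lra.
  move=> hs.
  have xq0 : 0 < `|x| * ((T + 1) / eps) by rewrite mulr_gt0.
  have hY : T + `|N| + 2 <= expR (a + s * x).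
    apply: le_trans (expR_ge1Dx _); have := ler_norm (- a); rewrite normrN; lra.
  have s0 : s != 0.
    apply: contraTneq hs => ->; rewrite mul0r -ltNge.
    have := normr_ge0 N; have := normr_ge0 a; lra.
  have s0' : 0 < `|s| by rewrite normr_gt0.
  have hY1 : T + 1 <= expR (a + s * x) by have := normr_ge0 N; lra.
  have [y [k [sub hit]]] := exp_wave_hole c s0 T0 r01 hY1.
  eexists; exists y; split; [|exact: sub|].
    apply/andP; split.
      by rewrite divr_gt0 ?mulr_gt0 ?expR_gt0//; lra.
    rewrite ltr_pdivrMr ?mulr_gt0 ?expR_gt0//.
    have : (T + 1) / eps < `|s|.
      rewrite -(ltr_pM2l x0') -normrM mulrC.
      apply: lt_le_trans (ler_norm _); rewrite [x * s]mulrC.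
      have := normr_ge0 N; have := normr_ge0 a; lra.
    rewrite ltr_pdivrMr// => h1.
    have : `|s| * eps <= eps * (expR (a + s * x) * `|s|).
      rewrite mulrC ler_pM2l// ler_peMl//; lra.
    lra.
  apply/seteqP; split => // z [/hit[h1 h2] [/(_ s Ss) hU _]]; apply: hU; split.
    have := ler_norm N; rewrite /=; lra.
  by exists k => //; rewrite -ball_normE /= distrC.
have : (@lebesgue_measure R).-negligible (E `|` [set 0]).
  apply: negligibleU; first exact/negligibleP.
  apply/negligibleP; [exact: measurable_set1|exact: lebesgue_measure_set1].
apply: negligibleS.
move=> x /= hx; have [->|/eqP x0] := eqVneq x 0; [by right|left].
split => // s Ss [hN [k _ hk]]; apply: hx; exists s, k; split => //.
by move: hk; rewrite -ball_normE /= distrC.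
Qed.

(** The null set can be chosen independently of [c], because it suffices to hit
    the countably many targets [j * r n], a grid of mesh half the
    tolerance; a shift by a multiple of [T] makes [c] nonnegative. *)
Lemma ae_exp_dense (R : realType) (T a : R) (S : set R) :
  0 < T ->
  (forall x : R, x != 0 -> forall M, exists2 s, S s & M <= s * x) ->
  {ae lebesgue_measure, forall x, forall (c : R) (n : nat), exists s (k : int),
    [/\ S s, n%:R < expR (a + s * x) &
        `|expR (a + s * x) - (c + k%:~R * T)| < n.+1%:R^-1]}.
Proof.
move=> T0 hS.
pose r n : R := (n.+1%:R * 2)^-1.
have : {ae @lebesgue_measure R, forall x, forall n j : nat, exists s (k : int),
    [/\ S s, n%:R < expR (a + s * x) &
        `|expR (a + s * x) - (j%:R * r n + k%:~R * T)| < r n]}.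
  apply/ae_foralln => n; apply/ae_foralln => j; apply: ae_exp_hits => //.
  rewrite invr_gt0 mulr_gt0//= invf_le1 ?mulr_gt0// -natrM ler1n.
  by rewrite muln_gt0.
apply: (@filterS _ _ (ae_filter_ringOfSetsType _)) => x hx c n.
have r0 : 0 < r n by rewrite invr_gt0 mulr_gt0.
pose K : int := Num.ceil (- c / T).
have hK : 0 <= c + K%:~R * T.
  by have := ceil_ge (- c / T); rewrite ler_pdivrMr// -/K; lra.
have hj := truncn_itv (divr_ge0 hK (ltW r0)).
move: hj; set j := Num.truncn _; rewrite ler_pdivlMr// ltr_pdivrMr// => hj.
have [s [k [Ss hs hd]]] := hx n j.
exists s, (k + K); split => //.
have -> : n.+1%:R^-1 = r n + r n by rewrite /r; field.
move: hd hj; rewrite !ltr_norml -natr1 rmorphD/=; lra.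
Qed.

(** * Topology and range of the complex exponential *)

Lemma periodicz (U : pzRingType) (V : zmodType) (f : U -> V) (T : U) :
  periodic f T -> forall (k : int) a, f (a + k%:~R * T) = f a.
Proof.
move=> fT [n|n] a; first by rewrite -pmulrn mulr_natl periodicn.
by rewrite NegzE mulrNz mulNr -pmulrn mulr_natl -[LHS](periodicn fT n.+1) subrK.
Qed.

(** Coordinatewise convergence suffices because the modulus is at most the sum
    of the absolute values of the coordinates. *)
Lemma closureC_cvg (R : realType) (A : set R[i]^o) (f g : nat -> R) (x y : R) :
  (forall n, A (Complex (f n) (g n))) ->
  f @ \oo --> x -> g @ \oo --> y -> closure A (Complex x y).
Proof.
move=> Afg /cvgrPdist_lt fx /cvgrPdist_lt gy B /nbhs_ballP[[e e']].
rewrite /= ltcE /= => /andP[/eqP -> e0] hB.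
have e20 : 0 < e / 2 by rewrite divr_gt0.
have [N _ /(_ _ (leqnn N))[hf hg]] := filterI (fx _ e20) (gy _ e20).
exists (Complex (f N) (g N)); split => //; apply: hB.
rewrite -ball_normE /= normc_def ltcR /=.
set a := x - f N in hf *; set b := y - g N in hg *.
apply: (@le_lt_trans _ _ (`|a| + `|b|)); last lra.
rewrite -[leRHS]ger0_norm ?addr_ge0// -sqrtr_sqr ler_sqrt ?sqr_ge0//.
rewrite [(_ + `|b|) ^+ 2]sqrrD !real_normK ?num_real// -addrA lerD2l lerDr.
by rewrite mulrn_wge0 ?mulr_ge0.
Qed.

Lemma diffquot_cvg (R : realType) (f : R -> R) (d : R) (y : nat -> R) :
  is_derive (0 : R) 1 f d -> (forall n, y n != 0) -> y @ \oo --> (0 : R) ->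
  (f (y n) - f 0) / y n @[n --> \oo] --> d.
Proof.
move=> [df <-] y0 yc.
have cy : y @ \oo --> 0^'.
  move=> P hP; have {}hP : \forall n \near \oo, y n != 0 -> P (y n) := yc _ hP.
  have [N hN hNP] := hP; exists N => // n Nn; exact: hNP n Nn (y0 n).
have := cvg_comp _ _ cy df; apply: cvg_trans.
apply: near_eq_cvg; near=> n; rewrite /= /shift /= addr0.
by rewrite -[y n *: 1]/(y n * 1) mulr1 mulrC.
Unshelve. all: by end_near. Qed.

Lemma expC_surj (R : realType) (x y : R) :
  (x != 0) || (y != 0) -> exists u v, expC (Complex u v) = Complex x y.
Proof.
move=> xy0; pose q : R := x ^+ 2 + y ^+ 2.
have q0 : 0 < q.
  rewrite lt_neqAle addr_ge0 ?sqr_ge0// andbT eq_sym.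
  by rewrite paddr_eq0 ?sqr_ge0// !sqrf_eq0 negb_and.
pose r := Num.sqrt q; have r0 : 0 < r by rewrite sqrtr_gt0.
have rq : r ^+ 2 = q by rewrite sqr_sqrtr// ltW.
have hx : -1 <= x / r <= 1.
  rewrite -ler_norml normrM [`|r^-1|]gtr0_norm ?invr_gt0// ler_pdivrMr// mul1r.
  by rewrite -[leLHS]sqrtr_sqr ler_sqrt ?(ltW q0)// lerDl sqr_ge0.
have hs : sin (acos (x / r)) = `|y| / r.
  rewrite sin_acos// -[RHS]ger0_norm ?(divr_ge0 _ (ltW r0))// -sqrtr_sqr.
  congr (Num.sqrt _).
  rewrite !expr_div_n real_normK ?num_real// rq /q; field.
  by rewrite gt_eqF.
have [y0|y0] := leP 0 y.
  exists (ln r), (acos (x / r)); rewrite /expC /= lnK// acosK// hs.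
  by rewrite (ger0_norm y0); simpc; congr Complex; field; rewrite gt_eqF.
exists (ln r), (- acos (x / r)); rewrite /expC /= lnK// cosN sinN acosK// hs.
by rewrite (ltr0_norm y0); simpc; congr Complex; field; rewrite gt_eqF.
Qed.

(** The range of the exponential omits only 0, which is the limit of the
    positive numbers [1 / (n + 1)]. *)
Lemma closure_expC (R : realType) (A : set R[i]^o) :
  (forall z, closure A (expC z)) -> closure A = [set: R[i]^o].
Proof.
move=> hA; apply/seteqP; split => // -[x y] _.
have [xy|] := boolP ((x != 0) || (y != 0)).
  by have [u [v <-]] := expC_surj xy; exact: hA.
rewrite negb_or !negbK => /andP[/eqP -> /eqP ->].
apply: (@closed_closure _ A).
apply: (@closureC_cvg _ _ (@harmonic R) (fun=> 0)).
- move=> n; have [|u [v <-]] := @expC_surj R (harmonic n) 0; last exact: hA.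
  by rewrite gt_eqF// harmonic_gt0.
- exact: cvg_harmonic.
- exact: cvg_cst.
Qed.

(** * Density of the image of the line *)

(** The parameters [t] at which the point [p + t (i + alpha)], with [b] the
    imaginary part of [p], is mapped by the exponential to the positive
    imaginary axis; they do not depend on [alpha]. *)
Definition crossings (R : realType) (b : R) : set R :=
  [set pi / 2 - b + k%:~R * (pi *+ 2) | k in [set: int]].

Lemma crossings_unbounded (R : realType) (b x : R) : x != 0 ->
  forall M, exists2 s, crossings b s & M <= s * x.
Proof.
move=> x0 M; pose T : R := pi *+ 2.
have T0 : 0 < T by rewrite pmulrn_lgt0// pi_gt0.
pose q := (M / x - (pi / 2 - b)) / T.
have [xn|xp|xz] := ltgtP x 0.
- exists (pi / 2 - b + (Num.floor q)%:~R * T); first by exists (Num.floor q).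
  rewrite -ler_ndivlMr// -lerBrDl -ler_pdivlMr//; exact: floor_le.
- exists (pi / 2 - b + (Num.ceil q)%:~R * T); first by exists (Num.ceil q).
  rewrite -ler_pdivrMr// -lerBlDl -ler_pdivrMr//; exact: ceil_ge.
- by rewrite xz eqxx in x0.
Qed.

(** Displacing the parameter by [d] from a crossing multiplies the purely
    imaginary value [i X] there by [exp (- d (i + alpha))]. *)
Lemma expC_near_crossing (R : realType) (a b alpha d s : R) :
  crossings b s ->
  expC (Complex a b + (s - d)%:C * ('i + alpha%:C))%C =
  Complex (expR (a + s * alpha) * (expR (- (alpha * d)) * sin d))
          (expR (a + s * alpha) * (expR (- (alpha * d)) * cos d)).
Proof.
move=> [k _ ks]; rewrite /expC; simpc => /=.
rewrite (_ : a + (s - d) * alpha = a + s * alpha + - (alpha * d)); last by ring.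
rewrite (_ : b + (s - d) = pi / 2 - d + k%:~R * (pi *+ 2)); last first.
  by rewrite -ks; set h := pi / 2; set T := _ * _; ring.
rewrite (periodicz (@cosD2pi R)) (periodicz (@sinD2pi R)).
rewrite [pi / 2 - d]addrC cosDpihalf sinDpihalf sinN cosN opprK expRD !mulrA.
by [].
Qed.

(** To approximate [exp (u + i v)], move away from a crossing with large modulus
    [X] by [d = u / X]. The first exponential then takes the value
    [X exp (- alpha d) (sin d + i cos d)], which is [u + i (X - alpha u)] up to
    a term tending to 0 as [X] grows, and the second one only sees the
    imaginary part modulo [2 pi]. Hence it is enough that [X] comes close to
    [v + alpha u] modulo [2 pi]. *)
Lemma closure_expC_expC (R : realType) (a b alpha : R) :
  (forall (c : R) (n : nat), exists s (k : int),
    [/\ crossings b s, n%:R < expR (a + s * alpha) &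
    `|expR (a + s * alpha) - (c + k%:~R * (pi *+ 2))| < n.+1%:R^-1]) ->
  forall z, closure ((@expC R \o @expC R) @` lineC alpha (Complex a b)
    : set R[i]^o) (expC z).
Proof.
move=> dense [u v].
pose good (n : nat) (sk : R * int) :=
    [/\ crossings b sk.1, n%:R < expR (a + sk.1 * alpha) &
    `|expR (a + sk.1 * alpha) - (v + alpha * u + sk.2%:~R * (pi *+ 2))|
      < n.+1%:R^-1].
have /choice[F hF] : forall n, exists sk, good n sk.
  by move=> n; have [s [k h]] := dense (v + alpha * u) n; exists (s, k).
pose y n := (expR (a + (F n).1 * alpha))^-1.
have y0 n : y n != 0 by rewrite invr_eq0 gt_eqF ?expR_gt0.
have yc : y @ \oo --> (0 : R).
  rewrite -cvg_shiftS.
  apply: (@squeeze_cvgr _ _ _ _ (fun=> 0) (@harmonic R)); last 2 first.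
  - exact: cvg_cst.
  - exact: cvg_harmonic.
  near=> n; rewrite /y invr_ge0 expR_ge0 /= lef_pV2 ?posrE ?expR_gt0//.
  by have [_ /ltW] := hF n.+1.
(* With [h = 1 / X], the real and imaginary parts of the first exponential are
   the quotients [phi h / h] and [psi h / h], so that their behaviour as [h]
   tends to 0 is read off from the derivatives of [phi] and [psi] at 0. *)
pose phi (h : R) := expR (- (alpha * (u * h))) * sin (u * h).
pose psi (h : R) := expR (- (alpha * (u * h))) * cos (u * h).
have dphi : is_derive (0 : R) 1 phi u.
  apply: is_derive_eq.
  by rewrite !(mulr0, oppr0, expR0, sin0, cos0) /GRing.scale /=; ring.
have dpsi : is_derive (0 : R) 1 psi (- (alpha * u)).
  apply: is_derive_eq.
  by rewrite !(mulr0, oppr0, expR0, sin0, cos0) /GRing.scale /=; ring.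
pose A n := phi (y n) / y n.
pose B n := psi (y n) / y n - (F n).2%:~R * (pi *+ 2).
have cA : A @ \oo --> u.
  rewrite (_ : A = fun n => (phi (y n) - phi 0) / y n).
    exact: diffquot_cvg dphi y0 yc.
  by apply/funext => n; rewrite /A [phi 0]/phi !mulr0 sin0 mulr0 subr0.
have cB : B @ \oo --> v.
  have -> : B = (fun n => (psi (y n) - psi 0) / y n +
     ((y n)^-1 - (v + alpha * u + (F n).2%:~R * (pi *+ 2))) + (v + alpha * u)).
    apply/funext => n; rewrite /B [psi 0]/psi !(mulr0, oppr0, expR0, cos0).
    by field; exact: y0.
  rewrite -[X in _ --> X](_ : - (alpha * u) + 0 + (v + alpha * u) = v);
    last by ring.
  apply: cvgD; last exact: cvg_cst.
  apply: cvgD; first exact: diffquot_cvg dpsi y0 yc.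
  apply/norm_cvg0P; apply: (@squeeze_cvgr _ _ _ _ (fun=> 0) (@harmonic R)).
  - near=> n; rewrite normr_ge0 /y invrK /=.
    by have [_ _ /ltW] := hF n.
  - exact: cvg_cst.
  - exact: cvg_harmonic.
rewrite /expC; simpc => /=.
apply: (@closureC_cvg _ _ (fun n => expR (A n) * cos (B n))
   (fun n => expR (A n) * sin (B n))).
- move=> n; have [cs _ _] := hF n.
  exists (Complex a b + ((F n).1 - u * y n)%:C * ('i + alpha%:C))%C.
    by exists ((F n).1 - u * y n).
  apply: etrans (congr1 (@expC R) (expC_near_crossing a alpha _ cs)) _.
  rewrite /expC /=; simpc.
  rewrite -[expR (a + _)]invrK -/(y n) -/(phi (y n)) -/(psi (y n)).
  rewrite -[cos (B n)](periodicz (@cosD2pi R) (F n).2).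
  rewrite -[sin (B n)](periodicz (@sinD2pi R) (F n).2).
  by rewrite /A /B subrK ![(y n)^-1 * _]mulrC.
- apply: cvgM; first by apply: continuous_cvg cA; exact: continuous_expR.
  by apply: continuous_cvg cB; exact: continuous_cos.
- apply: cvgM; first by apply: continuous_cvg cA; exact: continuous_expR.
  by apply: continuous_cvg cB; exact: continuous_sin.
Unshelve. all: by end_near. Qed.

(* R[i]^o is R[i] with the topology of its modulus *)
Theorem theorem1 (R : realType) (p : R[i]) :
  {ae (@lebesgue_measure R), forall alpha : R,
    closure ((@expC R \o @expC R) @` lineC alpha p : set R[i]^o) =
      [set: R[i]^o]}.
Proof.
case: p => a b; have T0 : 0 < pi *+ 2 :> R by rewrite pmulrn_lgt0// pi_gt0.
have := ae_exp_dense a T0 (@crossings_unbounded R b).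
apply: (@filterS _ _ (ae_filter_ringOfSetsType _)) => alpha dense.
exact: closure_expC (closure_expC_expC dense).
Qed.
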